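(* Let $m,n\ge 2$ and let $H_{m,n}$ be a connected simple graph whose vertex set is the disjoint union of three nonempty subsets $\{a_1,\dots,a_m,b_1,\dots,b_n\}$ (with $a_1,\dots,a_m,b_1,\dots,b_n$ distinct), $X_1$ and $Y_1$, satisfying the following conditions: (1) For all $1\le k\le n$ and $1\le r\le m$: $a_1$ and $a_2$ are adjacent to $b_k$, and $b_1$ and $b_2$ are adjacent to $a_r$. (2) $a_1$ is adjacent to each vertex of $X_1$, and $b_1$ is adjacent to each vertex of $Y_1$. (3) There is no edge between a vertex of $X_1$ and a vertex of $Y_1$. (4) There is no edge between any $a_i$ and a vertex of $Y_1$, and no edge between any $b_i$ and a vertex of $X_1$. (5) For all $i\neq 1$, there is no edge between $a_i$ and a vertex of $X_1$, and no edge between $b_i$ and a vertex of $Y_1$. (6) The subgraph induced on $\{a_1,\dots,a_m,b_1,\dots,b_n\}$ is a subgraph of the complete bipartite graph $K_{m,n}$ with parts $\{a_1,\dots,a_m\}$ and $\{b_1,\dots,b_n\}$. (7) The edges inside $X_1$ and inside $Y_1$ are arbitrary (the graph structures of the subgraphs induced on $X_1$ and $Y_1$ can be chosen freely). Then for every commutative semigroup $S$ with zero element, the zero-divisor graph $\Gamma(S)$ is not isomorphic to $H_{m,n}$.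
   Context: A semigroup is written multiplicatively, and its zero element $0$ satisfies $0x=0$ for all $x$. An element $x$ of a commutative semigroup $S$ with $0$ is a zero-divisor if $xy=0$ for some $y\in S$ with $y\ne 0$. The zero-divisor graph $\Gamma(S)$ is the undirected simple graph whose vertices are the nonzero zero-divisors of $S$, two distinct vertices $x,y$ being adjacent if and only if $xy=0$. *)

(* Defs.v *)
From Stdlib Require Import Relation_Operators.
From mathcomp Require Import all_boot.
From mathcomp Require Import monoid.
From mathcomp Require Import boolp classical_sets.

Set Implicit Arguments.
Unset Strict Implicit.
Unset Printing Implicit Defensive.

Local Open Scope group_scope.
Local Open Scope classical_set_scope.

(* The vertex set may be infinite. *)
Record sgraph := SGraph {
  vertex :> Type;
  adj : vertex -> vertex -> Prop;
  adj_sym : forall u v, adj u v -> adj v u;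
  adj_irrefl : forall u, ~ adj u u
}.

Definition connected_graph (G : sgraph) : Prop :=
  forall u v : G, clos_refl_trans G (@adj G) u v.

Definition graph_iso (G H : sgraph) : Prop :=
  exists2 f : G -> H, bijective f & forall u v : G, adj u v <-> adj (f u) (f v).

(* Built on magmaType because MathComp's semigroupType also requires a
   choiceType structure on the carrier. *)
Record comSemigroup0 := ComSemigroup0 {
  semigroup_carrier :> magmaType;
  szero : semigroup_carrier;
  smulA : associative (fun x y : semigroup_carrier => x * y);
  smulC : commutative (fun x y : semigroup_carrier => x * y);
  smul0 : forall x : semigroup_carrier, szero * x = szero
}.

Arguments szero {_}.

Definition zero_divisor (S : comSemigroup0) (x : S) : Prop :=
  exists2 y : S, y <> szero & x * y = szero.

Definition zdg_vertex (S : comSemigroup0) : Type :=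
  {x : S | x <> szero /\ zero_divisor x}.

Definition zdg_adj (S : comSemigroup0) (u v : zdg_vertex S) : Prop :=
  u <> v /\ sval u * sval v = szero.

Lemma zdg_adj_sym (S : comSemigroup0) (u v : zdg_vertex S) :
  zdg_adj u v -> zdg_adj v u.
Proof. by move=> [uv uv0]; split; [apply: nesym | rewrite smulC]. Qed.

Lemma zdg_adj_irrefl (S : comSemigroup0) (u : zdg_vertex S) : ~ zdg_adj u u.
Proof. by case. Qed.

Definition zero_divisor_graph (S : comSemigroup0) : sgraph :=
  SGraph (@zdg_adj_sym S) (@zdg_adj_irrefl S).

(* Indices are shifted by one: a_1, ..., a_m are a 0, ..., a (m - 1), so that
   "i < 2" picks out a_1 and a_2, and "i = 0" picks out a_1.  The edges inside
   X and inside Y are unconstrained. *)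
Record is_Hmn (m n : nat) (H : sgraph) (a : 'I_m -> H) (b : 'I_n -> H)
    (X Y : set H) : Prop := IsHmn {
  Hmn_connected : connected_graph H;
  Hmn_a_inj : injective a;
  Hmn_b_inj : injective b;
  Hmn_ab_disj : range a `&` range b = set0;
  Hmn_X_neq0 : X !=set0;
  Hmn_Y_neq0 : Y !=set0;
  Hmn_cover : (range a `|` range b) `|` X `|` Y = [set: H];
  Hmn_abX_disj : (range a `|` range b) `&` X = set0;
  Hmn_abY_disj : (range a `|` range b) `&` Y = set0;
  Hmn_XY_disj : X `&` Y = set0;
  Hmn_a12_b : forall (i : 'I_m) (k : 'I_n), (i < 2)%N -> adj (a i) (b k);
  Hmn_b12_a : forall (j : 'I_n) (r : 'I_m), (j < 2)%N -> adj (b j) (a r);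
  Hmn_a1_X : forall (i : 'I_m) (x : H), i = 0%N :> nat -> X x -> adj (a i) x;
  Hmn_b1_Y : forall (j : 'I_n) (y : H), j = 0%N :> nat -> Y y -> adj (b j) y;
  Hmn_XY_nadj : forall x y : H, X x -> Y y -> ~ adj x y;
  Hmn_a_Y : forall (i : 'I_m) (y : H), Y y -> ~ adj (a i) y;
  Hmn_b_X : forall (j : 'I_n) (x : H), X x -> ~ adj (b j) x;
  Hmn_a_X : forall (i : 'I_m) (x : H),
    i <> 0%N :> nat -> X x -> ~ adj (a i) x;
  Hmn_b_Y : forall (j : 'I_n) (y : H),
    j <> 0%N :> nat -> Y y -> ~ adj (b j) y;
  Hmn_bipartite : forall u v : H,
    (range a `|` range b) u -> (range a `|` range b) v -> adj u v ->
    (range a u /\ range b v) \/ (range b u /\ range a v)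
}.

(* Main.v *)
Require Import Defs.
From mathcomp Require Import all_boot.
From mathcomp Require Import monoid.
From mathcomp Require Import boolp classical_sets.

Set Implicit Arguments.
Unset Strict Implicit.
Unset Printing Implicit Defensive.

Local Open Scope group_scope.
Local Open Scope classical_set_scope.

(** The proof rests on one feature of the graph: the adjacent vertices [a_1] and
    [b_1] have no common neighbour.  A product of two vertices annihilates every
    neighbour of either factor, so a nonzero product annihilating both [a_1] and
    [b_1] is itself a vertex, and must be [a_1] or [b_1]
    ([common_annihilator]).

    Take [x] in [X_1] and [y] in [Y_1].  The products [x a_2], [y b_2] and [x y]
    all annihilate [a_1] and [b_1].  Since [x a_2] also annihilates [b_2], while
    [b_1] does not, [x a_2 = a_1]; symmetrically [y b_2 = b_1].  Hence
    [(x y) b_2 = x b_1] and [(x y) a_2 = y a_1] are nonzero.  But [x y] is [a_1],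
    which annihilates [b_2], or [b_1], which annihilates [a_2]: a contradiction
    ([no_annihilator_pattern]). *)

(** The semigroup core of the argument: the triple products [x y t] and [x y s]
    are nonzero, yet the only possible values of [x y] force one of them to
    vanish.  To be read with [p, q, s, t] standing for
    [a_1, b_1, a_2, b_2]. *)
Lemma no_annihilator_pattern (S : comSemigroup0) (p q s t x y : S) :
  (forall z : S, z <> szero -> z * p = szero -> z * q = szero ->
    z = p \/ z = q) ->
  p * x = szero -> p * t = szero -> q * y = szero -> q * s = szero ->
  s * t = szero ->
  p * s <> szero -> q * t <> szero ->
  x * q <> szero -> y * p <> szero -> x * s <> szero -> y * t <> szero ->
  False.
Proof.
move=> ann px pt qy qs st ps qt xq yp xs yt.
have m0 (u : S) : u * szero = szero by rewrite (smulC u) smul0.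
have xsp : x * s = p.
  case: (ann (x * s)) => //.
  - by rewrite (smulC x) -smulA (smulC x) px m0.
  - by rewrite -smulA (smulC s) qs m0.
  - by move=> xsq; case: qt; rewrite -xsq -smulA st m0.
have ytq : y * t = q.
  case: (ann (y * t)) => //.
  - by rewrite -smulA (smulC t) pt m0.
  - by rewrite (smulC y) -smulA (smulC y) qy m0.
  - by move=> ytp; case: ps; rewrite -ytp -smulA (smulC t) st m0.
have xyt : (x * y) * t <> szero by rewrite -smulA ytq.
have xys : (x * y) * s <> szero by rewrite (smulC x) -smulA xsp.
case: (ann (x * y)).
- by move=> xy0; apply: xyt; rewrite xy0 smul0.
- by rewrite (smulC x) -smulA (smulC x) px m0.
- by rewrite -smulA (smulC y) qy m0.
- by move=> xyp; apply: xyt; rewrite xyp.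
- by move=> xyq; apply: xys; rewrite xyq.
Qed.

Section Realization.

Variables (S : comSemigroup0) (H : sgraph) (g : H -> zero_divisor_graph S).
Hypothesis g_bij : bijective g.
Hypothesis g_adj : forall u v : H, adj u v <-> adj (g u) (g v).

Lemma adj_mul0 (u v : H) : adj u v -> sval (g u) * sval (g v) = szero.
Proof. by move=> /g_adj[]. Qed.

Lemma mul0_adj (u v : H) : sval (g u) * sval (g v) = szero ->
  u = v \/ adj u v.
Proof.
move=> uv0; have [->|nuv] := EM (u = v); first by left.
by right; apply/g_adj; split=> // /(bij_inj g_bij).
Qed.

Lemma nadj_mul_neq0 (u v : H) : u <> v -> ~ adj u v ->
  sval (g u) * sval (g v) <> szero.
Proof. by move=> nuv nadj /mul0_adj[]. Qed.

(** A nonzero [z] annihilating a vertex is itself a zero-divisor, hence a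
    vertex; it would be a common neighbour of [u] and [v] if it differed from
    both. *)
Lemma common_annihilator (u v : H) :
  (forall w : H, ~ (adj w u /\ adj w v)) ->
  forall z : S, z <> szero -> z * sval (g u) = szero ->
    z * sval (g v) = szero -> z = sval (g u) \/ z = sval (g v).
Proof.
move=> nocommon z z0 zu zv.
have zP : z <> szero /\ zero_divisor z.
  by split=> //; exists (sval (g u)) => //; case: (svalP (g u)).
have [h _ hK] := g_bij.
pose w : H := h (exist _ z zP).
have gw : sval (g w) = z by rewrite /w hK.
rewrite -gw in zu zv *.
have [->|wu] := mul0_adj zu; first by left.
have [->|wv] := mul0_adj zv; first by right.
by case: (nocommon w).
Qed.

End Realization.

Section Hmn.

Variables (H : sgraph).

(** The conditions are symmetric in the two sides, so each fact about the
    [a]'s and [X] below also serves for the [b]'s and [Y]. *)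
Lemma is_Hmn_swap (m n : nat) (a : 'I_m -> H) (b : 'I_n -> H) (X Y : set H) :
  is_Hmn a b X Y -> is_Hmn b a Y X.
Proof.
case=> Hc ai bi ab X0 Y0 cov abX abY XY a12 b12 a1X b1Y nXY naY nbX naX nbY bip.
split=> //.
- by rewrite setIC.
- by rewrite -cov (setUC (range b)) setUAC.
- by rewrite (setUC (range b)).
- by rewrite (setUC (range b)).
- by rewrite setIC.
- by move=> x y Yx Xy /adj_sym; apply: nXY.
- move=> u v; rewrite (setUC (range b)) => abu abv /(bip _ _ abu abv)[|];
  by [right | left].
Qed.

Variables (m n : nat) (a : 'I_m -> H) (b : 'I_n -> H) (X Y : set H).
Hypothesis HH : is_Hmn a b X Y.

Lemma Hmn_ab_neq (i : 'I_m) (j : 'I_n) : a i <> b j.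
Proof.
move=> ab; have : (range a `&` range b) (a i).
  by split; [exists i | exists j].
by rewrite (Hmn_ab_disj HH).
Qed.

Lemma Hmn_aa_nadj (i j : 'I_m) : ~ adj (a i) (a j).
Proof.
have ra k : (range a `|` range b) (a k) by left; exists k.
by move=> /(Hmn_bipartite HH (ra i) (ra j))[] [];
  [move=> _ [k _ /esym] | move=> [k _ /esym] + _]; apply: Hmn_ab_neq.
Qed.

Lemma Hmn_X_neq_b (x : H) (j : 'I_n) : X x -> x <> b j.
Proof.
move=> Xx xb; have : ((range a `|` range b) `&` X) x.
  by split=> //; right; exists j.
by rewrite (Hmn_abX_disj HH).
Qed.

Lemma Hmn_X_neq_a (x : H) (i : 'I_m) : X x -> x <> a i.
Proof.
move=> Xx xa; have : ((range a `|` range b) `&` X) x.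
  by split=> //; left; exists i.
by rewrite (Hmn_abX_disj HH).
Qed.

End Hmn.

(** Every vertex misses [a_i] or [b_j]: those among the [a]'s or the [b]'s by
    bipartiteness, those of [X] because no [b_j] sees [X], those of [Y] because
    no [a_i] sees [Y]. *)
Lemma Hmn_no_common_neighbour (H : sgraph) (m n : nat) (a : 'I_m -> H)
    (b : 'I_n -> H) (X Y : set H) (i : 'I_m) (j : 'I_n) :
  is_Hmn a b X Y -> forall w : H, ~ (adj w (a i) /\ adj w (b j)).
Proof.
move=> HH w [wa wb]; have : [set: H] w by [].
rewrite -(Hmn_cover HH) => -[[[[k _ kw]|[k _ kw]]|Xw]|Yw].
- by apply: (Hmn_aa_nadj HH (i := k) (j := i)); rewrite kw.
- by apply: (Hmn_aa_nadj (is_Hmn_swap HH) (i := k) (j := j)); rewrite kw.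
- exact: (Hmn_b_X HH Xw (adj_sym wb)).
- exact: (Hmn_a_Y HH Yw (adj_sym wa)).
Qed.

Theorem theorem3p3 :
  forall (m n : nat), (2 <= m)%N -> (2 <= n)%N ->
  forall (H : sgraph) (a : 'I_m -> H) (b : 'I_n -> H) (X1 Y1 : set H),
    is_Hmn a b X1 Y1 ->
  forall S : comSemigroup0, ~ graph_iso (zero_divisor_graph S) H.
Proof.
move=> m n m2 n2 H a b X Y HH S [f f_bij f_adj].
have HS := is_Hmn_swap HH.
have [g fK gK] := f_bij.
have g_bij : bijective g by exists f.
have g_adj (u v : H) : adj u v <-> adj (g u) (g v).
  by rewrite -{1}(gK u) -{1}(gK v); split=> /f_adj.
have [x Xx] := Hmn_X_neq0 HH; have [y Yy] := Hmn_Y_neq0 HH.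
pose i0 := Ordinal (ltnW m2); pose i1 := Ordinal m2.
pose j0 := Ordinal (ltnW n2); pose j1 := Ordinal n2.
have ne_a : a i0 <> a i1 by move/(Hmn_a_inj HH).
have ne_b : b j0 <> b j1 by move/(Hmn_b_inj HH).
pose e u := sval (g u).
apply: (@no_annihilator_pattern S (e (a i0)) (e (b j0)) (e (a i1)) (e (b j1))
          (e x) (e y)).
- exact: common_annihilator g_bij g_adj _ _ (Hmn_no_common_neighbour HH).
- by apply: adj_mul0 => //; apply: (Hmn_a1_X HH).
- by apply: adj_mul0 => //; apply: (Hmn_a12_b HH).
- by apply: adj_mul0 => //; apply: (Hmn_b1_Y HH).
- by apply: adj_mul0 => //; apply: (Hmn_b12_a HH).
- by apply: adj_mul0 => //; apply: (Hmn_a12_b HH).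
- by apply: nadj_mul_neq0 => //; apply: (Hmn_aa_nadj HH).
- by apply: nadj_mul_neq0 => //; apply: (Hmn_aa_nadj HS).
- apply: nadj_mul_neq0 => //; first exact: (Hmn_X_neq_b HH).
  by move=> /adj_sym; apply: (Hmn_b_X HH).
- apply: nadj_mul_neq0 => //; first exact: (Hmn_X_neq_b HS).
  by move=> /adj_sym; apply: (Hmn_a_Y HH).
- apply: nadj_mul_neq0 => //; first exact: (Hmn_X_neq_a HH).
  by move=> /adj_sym; apply: (Hmn_a_X HH).
- apply: nadj_mul_neq0 => //; first exact: (Hmn_X_neq_a HS).
  by move=> /adj_sym; apply: (Hmn_b_Y HH).
Qed.
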